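(* For all positive integers $M$ and $s^{(1)},\dots,s^{(M)}$ there exist positive constants $C_5,C_6,C_7,C_8$, depending only on $s^{(1)},\dots,s^{(M)}$, such that the following holds. Suppose that the node set $\mathcal{X}=\{x_1,\dots,x_s\}\subset(-\pi,\pi]$ (with $s=\sum_j s^{(j)}$) forms an $((h^{(j)},s^{(j)})_{j=1}^M,\theta)$-clustered configuration, with clusters $\mathcal{C}^{(1)},\dots,\mathcal{C}^{(M)}$. Let $\sigma_1\ge\dots\ge\sigma_s$ be the singular values of $\mathbf{V}_N(\mathcal{X})$ in non-increasing order, and let $\tilde\sigma_1\ge\dots\ge\tilde\sigma_s$ be all the singular values of the sub-matrices $\mathbf{V}_N(\mathcal{C}^{(1)}),\dots,\mathbf{V}_N(\mathcal{C}^{(M)})$ (collected together with multiplicity), also in non-increasing order. Put $h=\max_j h^{(j)}$. Then for all integers $N$ satisfying $\frac{C_5}{\theta}\le N\le\frac{C_6}{h}$ we have $$\left(1-\frac{C_7}{N\theta}-C_8Nh\right)^{1/2}\tilde\sigma_j\ \le\ \sigma_j\ \le\ \left(1+\frac{C_7}{N\theta}+C_8Nh\right)^{1/2}\tilde\sigma_j,\qquad j=1,\dots,s.$$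
   Context: Wrap-around distance: for $x,y\in\mathbb{R}$, $\Delta(x,y)=|\operatorname{Arg}(e^{\imath(x-y)})|\in[0,\pi]$, where $\operatorname{Arg}$ is the principal argument with values in $(-\pi,\pi]$. Cluster: for $h>0$, a set of $s$ distinct nodes in $(-\pi,\pi]$ forms an $(h,s)$-cluster if $0<\Delta(x,y)\le h$ for all distinct $x,y$ in the set. Clustered configuration: $\mathcal{X}=\{x_1,\dots,x_s\}\subset(-\pi,\pi]$ forms an $((h^{(j)},s^{(j)})_{j=1}^M,\theta)$-clustered configuration if there is a partition $\mathcal{X}=\biguplus_{j=1}^M\mathcal{C}^{(j)}$ such that for each $j$: $\mathcal{C}^{(j)}$ is an $(h^{(j)},s^{(j)})$-cluster, and $\Delta(x,y)\ge\theta>0$ for all $x\in\mathcal{C}^{(j)}$, $y\in\mathcal{X}\setminus\mathcal{C}^{(j)}$. Vandermonde matrix: for a set of $n$ distinct nodes $\mathcal{Z}=\{z_1,\dots,z_n\}\subset(-\pi,\pi]$ (with a fixed ordering), $\mathbf{V}_N(\mathcal{Z})$ is the $(N+1)\times n$ matrix with entries $e^{\imath k z_j}$ ($k=0,\dots,N$, $j=1,\dots,n$). Throughout, $N\ge s-1$. *)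

(* Defs.v *)
From mathcomp Require Import all_boot all_order all_algebra.
From mathcomp Require Import all_classical all_reals all_analysis.
From mathcomp Require Export complex.

Set Implicit Arguments.
Unset Strict Implicit.
Unset Printing Implicit Defensive.

Import Order.TTheory GRing.Theory Num.Theory.
Local Open Scope classical_set_scope.
Local Open Scope ring_scope.
Local Open Scope complex_scope.
Local Open Scope sesquilinear_scope.

(* e^(i t) *)
Definition expi (R : realType) (t : R) : R[i] := cos t +i* sin t.

(* Only meaningful for z != 0, where the chosen t exists and is unique. *)
Definition Arg (R : realType) (z : R[i]) : R :=
  xget 0 [set t | - pi < t <= pi /\ z = `|z| * expi t].

Definition wrap_dist (R : realType) (x y : R) : R := `|Arg (expi (x - y))|.

(* A finite set of nodes together with an ordering of it is a duplicate-free
   sequence. *)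
Definition node_set (R : realType) (X : seq R) : Prop :=
  uniq X /\ {in X, forall x, - pi < x <= pi}.

Definition node_cluster (R : realType) (h : R) (s : nat) (C : seq R) : Prop :=
  [/\ 0 < h, node_set C, size C = s &
      {in C &, forall x y, x != y -> 0 < wrap_dist x y <= h}].

(* The second and third clauses say that X is the disjoint union of the C j. *)
Definition clustered_configuration (R : realType) (M : nat) (h : 'I_M -> R)
    (s : 'I_M -> nat) (theta : R) (X : seq R) (C : 'I_M -> seq R) : Prop :=
  [/\ node_set X,
      forall x, (x \in X) = [exists j, x \in C j],
      forall (i j : 'I_M) x, x \in C i -> x \in C j -> i = j,
      forall j, node_cluster (h j) (s j) (C j) &
      0 < theta /\
      forall (j : 'I_M) x y, x \in C j -> y \in X -> y \notin C j ->
        theta <= wrap_dist x y].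

Definition vandermonde (R : realType) (N : nat) (Z : seq R) :
    'M[R[i]]_(N.+1, size Z) :=
  \matrix_(k < N.+1, j < size Z) expi (k%:R * Z`_j).

(* Square roots of the eigenvalues of A^* A, with multiplicity, in
   non-increasing order. For n <= m these are exactly the min(m, n) singular
   values; for m < n the list is padded with n - m zeros. *)
Definition singular_values (R : realType) (m n : nat) (A : 'M[R[i]]_(m, n)) :
    seq R :=
  sort >=%R
    [seq Num.sqrt (complex.Re (spectral_diag (A ^t* *m A) 0 j)) | j : 'I_n].

Definition cluster_singular_values (R : realType) (M N : nat)
    (C : 'I_M -> seq R) : seq R :=
  sort >=%R
    (flatten [seq singular_values (vandermonde N (C j)) | j : 'I_M]).

(* Main.v *)
(* Averaging g(k + l) z^-l over m consecutive l kills the node z in g minus its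
   average, so by induction any s-term exponential sum g on {0, ..., N} with
   unimodular nodes satisfies sup |g|^2 <= (K_s / N) |g|_2^2, and, if the nodes
   are within O(1/N) of 1, also |g(k+1) - g(k)| <= (K_s / N) sup |g|.  Hence the
   modulated sums attached to two clusters, whose carrier frequencies are at
   distance >= theta, are almost orthogonal by Abel summation, with a cosine
   O(1 / (N theta)).  So |V x|^2 and the sum of the |V_j x_j|^2 differ by a
   relative error O(1 / (N theta)), and the min-max principle compares the
   singular values. *)
Require Import Defs.
From mathcomp Require Import all_boot all_order all_algebra.
From mathcomp Require Import all_classical all_reals all_analysis.
From mathcomp Require Import ring lra zify.

Set Implicit Arguments.
Unset Strict Implicit.

Import Order.TTheory GRing.Theory Num.Theory.
Import numFieldNormedType.Exports.
Local Open Scope ring_scope.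
Local Open Scope sesquilinear_scope.

(** * Exponential sums with unimodular nodes *)

Section ExponentialSums.
Variable C : numClosedFieldType.
Implicit Types (g : nat -> C) (ps qs : seq (C * C)) (eta B : C).

Lemma norm_double_mul_le (a b : C) : 2 * (`|a| * `|b|) <= `|a| ^+ 2 + `|b| ^+ 2.
Proof.
rewrite -subr_ge0.
have -> : `|a| ^+ 2 + `|b| ^+ 2 - 2 * (`|a| * `|b|) = (`|a| - `|b|) ^+ 2 by ring.
by rewrite real_exprn_even_ge0 ?rpredB ?normr_real.
Qed.

Lemma sqr_normD_le (a b : C) : `|a + b| ^+ 2 <= 2 * `|a| ^+ 2 + 2 * `|b| ^+ 2.
Proof.
have h : `|a + b| ^+ 2 <= (`|a| + `|b|) ^+ 2.
  by rewrite lerXn2r ?nnegrE ?addr_ge0 // ler_normD.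
apply: le_trans h _.
have -> : (`|a| + `|b|) ^+ 2 = `|a| ^+ 2 + `|b| ^+ 2 + 2 * (`|a| * `|b|) by ring.
have -> : 2 * `|a| ^+ 2 + 2 * `|b| ^+ 2 =
  `|a| ^+ 2 + `|b| ^+ 2 + (`|a| ^+ 2 + `|b| ^+ 2) by ring.
by rewrite lerD2l norm_double_mul_le.
Qed.

Lemma sqr_norm_sum_le n (a : nat -> C) :
  `|\sum_(l < n) a l| ^+ 2 <= n%:R * \sum_(l < n) `|a l| ^+ 2.
Proof.
have h : `|\sum_(l < n) a l| ^+ 2 <= (\sum_(l < n) `|a l|) ^+ 2.
  by rewrite lerXn2r ?nnegrE ?sumr_ge0 // ler_norm_sum.
apply: le_trans h _.
elim: n => [|n IHn]; first by rewrite !big_ord0 mul0r expr0n.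
rewrite !big_ord_recr /=.
set S := \sum_(i < n) `|a i| in IHn *; set Q := \sum_(i < n) `|a i| ^+ 2 in IHn *.
have hc : 2 * (S * `|a n|) <= Q + n%:R * `|a n| ^+ 2.
  rewrite /S /Q mulr_suml mulr_sumr.
  have -> : n%:R * `|a n| ^+ 2 = \sum_(i < n) `|a n| ^+ 2.
    by rewrite sumr_const card_ord mulr_natl.
  by rewrite -big_split /=; apply: ler_sum => i _; apply: norm_double_mul_le.
have -> : (S + `|a n|) ^+ 2 = S ^+ 2 + 2 * (S * `|a n|) + `|a n| ^+ 2 by ring.
have -> : n.+1%:R * (Q + `|a n| ^+ 2) =
  n%:R * Q + (Q + n%:R * `|a n| ^+ 2) + `|a n| ^+ 2.
  by rewrite -natr1; ring.
by rewrite lerD2r lerD.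
Qed.

Lemma sum_shift_le n b n' (F : nat -> C) : (forall l, 0 <= F l) ->
  (n + b <= n')%N -> \sum_(l < n) F (l + b)%N <= \sum_(l < n') F l.
Proof.
move=> F0 le_n'.
rewrite -(big_mkord predT F) -(big_mkord predT (fun l => F (l + b)%N)).
have -> : \sum_(0 <= l < n) F (l + b)%N = \sum_(b <= l < n + b) F l.
  by rewrite -[in RHS](add0n b) big_addn add0n addnK.
have le_b : (b <= n')%N := leq_trans (leq_addl n b) le_n'.
rewrite [leRHS](big_cat_nat (leq0n b) le_b) /=.
rewrite [X in _ <= _ + X](big_cat_nat (leq_addl n b) le_n') /=.
rewrite [X in _ <= X]addrCA lerDl addr_ge0 //; exact: sumr_ge0.
Qed.

(** * Exponential sums and the removal of one frequency by averaging *)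

Definition expsum ps (k : nat) : C := \sum_(p <- ps) p.1 * p.2 ^+ k.

(* [avg m z] fixes [k |-> z ^+ k] and multiplies every other [k |-> w ^+ k] by a
   scalar, so [g - avg m z g] has one term less than the exponential sum [g]. *)
Definition avg (m : nat) (z : C) g (k : nat) : C :=
  m%:R^-1 * \sum_(l < m) z^-1 ^+ l.+1 * g (k + l.+1)%N.

(** The list [qs] keeps the nodes of [ps] and changes only the amplitudes. Hypotheses on the nodes
    thus pass to [qs], which makes induction on the number of terms possible, with constants
    independent of the amplitudes and of the node spacing. *)
Lemma sub_avg_expsum m z c ps : (0 < m)%N -> z != 0 ->
  let qs := [seq (p.1 * (1 - avg m z (GRing.exp p.2) 0), p.2) | p <- ps] in
  forall k, expsum ((c, z) :: ps) k - avg m z (expsum ((c, z) :: ps)) k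
            = expsum qs k.
Proof.
move=> m0 z0 qs k.
have avg_exp a w i :
    avg m z (fun j => a * w ^+ j) i = avg m z (GRing.exp w) 0 * (a * w ^+ i).
  rewrite /avg -!mulrA; congr (_ * _); rewrite mulr_suml.
  by apply: eq_bigr => l _; rewrite add0n exprD; ring.
have -> : avg m z (expsum ((c, z) :: ps)) k =
    \sum_(p <- (c, z) :: ps) avg m z (fun j => p.1 * p.2 ^+ j) k.
  rewrite /avg -mulr_sumr exchange_big /=; congr (_ * _).
  by apply: eq_bigr => l _; rewrite /expsum mulr_sumr.
rewrite /expsum -sumrB big_cons /= avg_exp.
have -> : avg m z (GRing.exp z) 0 = 1.
  rewrite /avg (eq_bigr (fun=> 1)) => [|l _].
    by rewrite sumr_const card_ord mulVf // pnatr_eq0 -lt0n.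
  by rewrite add0n -exprMn mulVf // expr1n.
rewrite mul1r subrr add0r big_map /=; apply: eq_bigr => p _.
by rewrite avg_exp; ring.
Qed.

Lemma norm_avg_le m z g k B : (0 < m)%N -> `|z| = 1 ->
  (forall l, (l <= m)%N -> `|g (k + l)%N| <= B) -> `|avg m z g k| <= B.
Proof.
move=> m0 z1 gB.
rewrite /avg normrM normfV normr_nat ler_pdivrMl ?ltr0n //.
apply: le_trans (ler_norm_sum _ _ _) _.
rewrite mulr_natl -[m in X in _ <= X]card_ord -sumr_const; apply: ler_sum => l _.
by rewrite normrM normrX normfV z1 invr1 expr1n mul1r gB.
Qed.

Lemma sqr_norm_avg_le m z g k : (0 < m)%N -> `|z| = 1 ->
  `|avg m z g k| ^+ 2 <= m%:R^-1 * \sum_(l < m) `|g (k + l.+1)%N| ^+ 2.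
Proof.
move=> m0 z1; rewrite /avg normrM exprMn normfV normr_nat.
rewrite expr2 -mulrA ler_pM2l ?invr_gt0 ?ltr0n // ler_pdivrMl ?ltr0n //.
apply: le_trans (sqr_norm_sum_le m (fun l => z^-1 ^+ l.+1 * g (k + l.+1)%N)) _.
rewrite ler_pM2l ?ltr0n //; apply: ler_sum => l _.
by rewrite normrM normrX normfV z1 invr1 expr1n mul1r.
Qed.

(** Moving the window one step multiplies the average by [z], up to the two end terms. The factor
    [z - 1] costs [eta * B], the end terms [2 * B / m]. *)
Lemma avg_diff_le m z g k eta B : (0 < m)%N -> `|z| = 1 -> `|z - 1| <= eta ->
  (forall l, (l <= m.+1)%N -> `|g (k + l)%N| <= B) ->
  `|avg m z g k.+1 - avg m z g k| <= (2 / m%:R + eta) * B.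
Proof.
move=> m0 z1 zeta gB.
have z0 : z != 0 by rewrite -normr_eq0 z1 oner_eq0.
have B0 : 0 <= B by apply: le_trans (gB 0%N isT).
have -> : avg m z g k.+1 - avg m z g k = (z - 1) * avg m z g k +
    m%:R^-1 * (z^-1 ^+ m * g (k + m.+1)%N - g (k + 1)%N).
  pose a l := z^-1 ^+ l.+1 * g (k + l.+1)%N.
  have za l : z * a l = z^-1 ^+ l * g (k + l.+1)%N.
    by rewrite /a exprS !mulrA mulfV // mul1r.
  have avgS : avg m z g k.+1 = m%:R^-1 * (z * \sum_(l < m) a l.+1).
    congr (_ * _); rewrite mulr_sumr; apply: eq_bigr => l _.
    by rewrite za addSnnS.
  have sumS : \sum_(l < m) a l.+1 = \sum_(l < m) a l + a m - a 0%N.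
    apply/eqP; rewrite eq_sym subr_eq -(big_ord_recr m (fun l => a l)) big_ord_recl.
    by rewrite addrC.
  rewrite avgS sumS !(mulrDr z) mulrN !za expr0 mul1r /avg -/(a _).
  by rewrite (eq_bigr (fun l : 'I_m => a l)) //; ring.
apply: le_trans (ler_normD _ _) _; rewrite [leRHS]mulrDl [leRHS]addrC lerD //; last first.
  rewrite normrM normfV normr_nat -mulrA mulrCA ler_pM2l ?invr_gt0 ?ltr0n //.
  apply: le_trans (ler_normB _ _) _.
  rewrite normrM normrX normfV z1 invr1 expr1n mul1r.
  by rewrite mulr_natl mulr2n lerD // gB.
rewrite normrM ler_pM // norm_avg_le // => l lm; exact/gB/leqW.
Qed.

(** Induction on the number of terms: [g] is its average at [z], controlled by the energy through
    Cauchy-Schwarz, plus a sum with one term less. Each term consumes a window of length [m]. *)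
Lemma expsum_sup m ps k : (0 < m)%N -> {in ps, forall p, `|p.2| = 1} ->
  `|expsum ps k| ^+ 2 <= 10 ^+ size ps / m%:R *
     \sum_(l < (size ps * m).+1) `|expsum ps (k + l)| ^+ 2.
Proof.
move=> m0 z1.
have mV : 0 <= m%:R^-1 :> C by rewrite invr_ge0 ler0n.
have [n sz] : exists n, size ps = n by exists (size ps).
rewrite sz; elim: n ps k sz z1 => [|n IHn] [|[c z] ps] k //= => [_ _|[sz] z1].
  by rewrite {1}/expsum big_nil normr0 expr0n mulr_ge0 ?mulr_ge0 ?sumr_ge0 // => i _;
     rewrite exprn_ge0.
have zn : `|z| = 1 by apply: (z1 (c, z)); rewrite inE eqxx.
have z0 : z != 0 by rewrite -normr_eq0 zn oner_eq0.
have := sub_avg_expsum c ps m0 z0.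
set g := expsum ((c, z) :: ps); set qs := map _ ps => /= gq.
have IHq i : `|expsum qs i| ^+ 2 <= 10 ^+ n / m%:R *
     \sum_(l < (n * m).+1) `|expsum qs (i + l)| ^+ 2.
  apply: IHn; first by rewrite size_map.
  by move=> p /mapP[q qps ->] /=; apply: z1; rewrite inE qps orbT.
set W := \sum_(l < _) _.
have W0 : 0 <= W by apply: sumr_ge0 => i _; rewrite exprn_ge0.
have gk i : `|g i| ^+ 2 <= 2 * `|expsum qs i| ^+ 2 + 2 * `|avg m z g i| ^+ 2.
  by rewrite -[X in `|X| ^+ 2](subrK (avg m z g i)) gq; exact: sqr_normD_le.
have qk i : `|expsum qs i| ^+ 2 <= 2 * `|g i| ^+ 2 + 2 * `|avg m z g i| ^+ 2.
  by rewrite -gq -[X in _ + 2 * X ^+ 2]normrN; exact: sqr_normD_le.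
have avW : `|avg m z g k| ^+ 2 <= m%:R^-1 * W.
  apply: le_trans (sqr_norm_avg_le _ _ m0 zn) _; rewrite ler_wpM2l //.
  under eq_bigr do rewrite -addn1.
  apply: (@sum_shift_le m 1 _ (fun l => `|g (k + l)%N| ^+ 2)).
    by move=> l; rewrite exprn_ge0.
  by rewrite addn1 ltnS mulSn leq_addr.
(* On the shorter window [g] and its average both have energy at most [W], since shifts by at most
   [m] stay inside the longer one; hence 2 W + 2 W. *)
have sq : \sum_(l < (n * m).+1) `|expsum qs (k + l)| ^+ 2 <= 4 * W.
  apply: (@le_trans _ _ (2 * W + 2 * (m%:R^-1 * (m%:R * W)))); last first.
    by rewrite mulKf ?pnatr_eq0 -?lt0n // -mulrDl -natrD.
  apply: le_trans (ler_sum _ (fun (l : 'I_(n * m).+1) _ => qk (k + l)%N)) _.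
  rewrite big_split /= -!mulr_sumr lerD // ler_wpM2l //.
    rewrite (eq_bigr (fun l : 'I_(n * m).+1 => `|g (k + (l + 0))%N| ^+ 2)).
      apply: (@sum_shift_le _ 0 _ (fun l => `|g (k + l)%N| ^+ 2)).
        by move=> l; rewrite exprn_ge0.
      by rewrite addn0 ltnS mulSn leq_addl.
    by move=> l _; rewrite addn0.
  apply: (@le_trans _ _ (\sum_(l < (n * m).+1)
      m%:R^-1 * \sum_(i < m) `|g (k + l + i.+1)%N| ^+ 2)).
    by apply: ler_sum => l _; apply: sqr_norm_avg_le.
  rewrite -mulr_sumr ler_wpM2l // exchange_big /=.
  rewrite mulr_natl -[m in X in _ <= X]card_ord -sumr_const; apply: ler_sum => i _.
  under eq_bigr do rewrite -addnA.
  apply: (@sum_shift_le _ i.+1 _ (fun l => `|g (k + l)%N| ^+ 2)).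
    by move=> l; rewrite exprn_ge0.
  by rewrite addSn ltnS mulSn addnC leq_add2r.
apply: le_trans (gk k) _.
apply: (@le_trans _ _ (2 * (10 ^+ n / m%:R * (4 * W)) + 2 * (m%:R^-1 * W))).
  rewrite lerD // ler_wpM2l //; apply: le_trans (IHq k) _.
  by rewrite ler_wpM2l // mulr_ge0 // exprn_ge0.
have -> : 2 * (10 ^+ n / m%:R * (4 * W)) + 2 * (m%:R^-1 * W) =
  (8 * 10 ^+ n + 2) * (m%:R^-1 * W) by ring.
(* The recursion 8 * 10^n + 2 <= 10^(n+1) is the source of the base 10. *)
rewrite exprS -mulrA ler_wpM2r ?mulr_ge0 //.
rewrite [X in _ <= X](_ : _ = 8 * 10 ^+ n + 2 * 10 ^+ n); last by ring.
by rewrite lerD2l ler_peMr // exprn_ege1 // ler1n.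
Qed.

(** Same induction as for [expsum_sup]: the average varies slowly by [avg_diff_le], and the
    remainder is bounded by [2 * B] on a shorter window. The base 3 comes from 2 * 3^n + 1 <=
    3^(n+1). *)
Lemma expsum_diff_le m ps k eta B : (0 < m)%N -> 0 <= eta ->
  {in ps, forall p, `|p.2| = 1 /\ `|p.2 - 1| <= eta} ->
  (forall l, (l <= (size ps * m).+1)%N -> `|expsum ps (k + l)| <= B) ->
  `|expsum ps k.+1 - expsum ps k| <= 3 ^+ size ps * ((2 / m%:R + eta) * B).
Proof.
move=> m0 eta0.
have mV : 0 <= 2 / m%:R + eta by rewrite addr_ge0 // divr_ge0 ?ler0n.
have [n sz] : exists n, size ps = n by exists (size ps).
rewrite sz; elim: n ps B sz => [|n IHn] [|[c z] ps] B //= => [_ _ gB|[sz] z1].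
  rewrite /expsum !big_nil subrr normr0 expr0 mul1r mulr_ge0 //.
  exact: le_trans (gB 0%N isT).
have [zn zeta] : `|z| = 1 /\ `|z - 1| <= eta by apply: (z1 (c, z)); rewrite inE eqxx.
have z0 : z != 0 by rewrite -normr_eq0 zn oner_eq0.
have := sub_avg_expsum c ps m0 z0.
set g := expsum ((c, z) :: ps); set qs := map _ ps => /= gq gB.
have B0 : 0 <= B by apply: le_trans (gB 0%N isT).
have avB l : (l <= (n * m).+1)%N -> `|avg m z g (k + l)| <= B.
  move=> hl; apply: norm_avg_le => // i im; rewrite -addnA gB //.
  by rewrite mulSn -addnS addnC leq_add.
have IHq : `|expsum qs k.+1 - expsum qs k| <= 3 ^+ n * ((2 / m%:R + eta) * (2 * B)).
  apply: IHn; first by rewrite size_map.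
    by move=> p /mapP[q qps ->] /=; apply: z1; rewrite inE qps orbT.
  move=> l hl; rewrite -gq mulr_natl mulr2n; apply: le_trans (ler_normB _ _) _.
  by rewrite lerD ?avB // gB // (leq_trans hl) // ltnS mulSn leq_addl.
have avd : `|avg m z g k.+1 - avg m z g k| <= (2 / m%:R + eta) * B.
  apply: avg_diff_le => // l hl; apply: gB; apply: leq_trans hl _.
  by rewrite ltnS mulSn leq_addr.
have -> : g k.+1 - g k =
    (expsum qs k.+1 - expsum qs k) + (avg m z g k.+1 - avg m z g k).
  by rewrite -!gq; ring.
apply: le_trans (ler_normD _ _) _.
apply: le_trans (lerD IHq avd) _.
set D := (2 / m%:R + eta) in mV *.
have -> : 3 ^+ n * (D * (2 * B)) + D * B = (2 * 3 ^+ n + 1) * (D * B) by ring.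
rewrite ler_wpM2r ?mulr_ge0 // exprS.
rewrite [X in _ <= X](_ : _ = 2 * 3 ^+ n + 3 ^+ n); last by ring.
by rewrite lerD2l exprn_ege1 // ler1n.
Qed.


(* Time reversal turns the right-sided windows above into left-sided ones, so a
   window inside [0, N] is available at every index. *)
Lemma expsum_rev N ps k : (k <= N)%N -> {in ps, forall p, `|p.2| = 1} ->
  expsum [seq (p.1 * p.2 ^+ N, p.2^-1) | p <- ps] k = expsum ps (N - k).
Proof.
move=> kN z1; rewrite /expsum big_map /= !big_seq; apply: eq_bigr => p /z1 p1.
have p0 : p.2 != 0 by rewrite -normr_eq0 p1 oner_eq0.
by rewrite -mulrA -{1}(subnK kN) exprD -mulrA -exprMn mulfV // expr1n mulr1.
Qed.

(** At each index of [0, N] either the window to the right fits or, since [2 * (size ps * m) <= N],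
    the one to the left does; the second case is the first one for the reversed sum. *)
Lemma expsum_sup_window N m ps k : (0 < m)%N -> (2 * (size ps * m) <= N)%N ->
  {in ps, forall p, `|p.2| = 1} -> (k <= N)%N ->
  `|expsum ps k| ^+ 2 <= 10 ^+ size ps / m%:R * \sum_(l < N.+1) `|expsum ps l| ^+ 2.
Proof.
have onesided ps' j : (0 < m)%N -> {in ps', forall p, `|p.2| = 1} ->
    (j + size ps' * m <= N)%N -> `|expsum ps' j| ^+ 2 <=
      10 ^+ size ps' / m%:R * \sum_(l < N.+1) `|expsum ps' l| ^+ 2.
  move=> m0 z1 jN; apply: le_trans (expsum_sup _ m0 z1) _.
  rewrite ler_wpM2l ?divr_ge0 ?exprn_ge0 ?ler0n //.
  under eq_bigr do rewrite addnC.
  apply: (@sum_shift_le _ j _ (fun l => `|expsum ps' l| ^+ 2)).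
    by move=> l; rewrite exprn_ge0.
  by rewrite addSn ltnS addnC.
move=> m0 sN z1 kN; have [kr|kl] := leqP (k + size ps * m) N; first exact: onesided.
pose qs := [seq (p.1 * p.2 ^+ N, p.2^-1) | p <- ps].
have sq : size qs = size ps by rewrite size_map.
have -> : expsum ps k = expsum qs (N - k) by rewrite expsum_rev ?leq_subr ?subKn.
rewrite (reindex_inj rev_ord_inj) /=.
rewrite (eq_bigr (fun l : 'I_N.+1 => `|expsum qs l| ^+ 2)); last first.
  by move=> l _; rewrite subSS expsum_rev // -ltnS.
rewrite -sq; apply: onesided => //.
  by move=> p /mapP[q qps ->] /=; rewrite normfV z1 // invr1.
rewrite sq; move: kl sN kN; move: (size ps * m)%N => t; lia.
Qed.

Lemma expsum_diff_window N m ps k eta B : (0 < m)%N -> (2 * (size ps * m) <= N)%N ->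
  0 <= eta -> {in ps, forall p, `|p.2| = 1 /\ `|p.2 - 1| <= eta} ->
  (forall l, (l <= N)%N -> `|expsum ps l| <= B) -> (k < N)%N ->
  `|expsum ps k.+1 - expsum ps k| <= 3 ^+ size ps * ((2 / m%:R + eta) * B).
Proof.
move=> m0 sN eta0 z1 gB kN.
have [kr|kl] := ltnP (k + size ps * m) N.
  by apply: expsum_diff_le => // l hl; apply: gB; lia.
have z1' : {in ps, forall p, `|p.2| = 1} by move=> p /z1[].
pose qs := [seq (p.1 * p.2 ^+ N, p.2^-1) | p <- ps].
have sq : size qs = size ps by rewrite size_map.
have -> : expsum ps k.+1 = expsum qs (N - k.+1).
  by rewrite expsum_rev ?leq_subr // subKn.
(* Reversal exchanges the roles of [k] and [k.+1], hence the [distrC] below. *)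
have -> : expsum ps k = expsum qs (N - k.+1).+1.
  by rewrite expsum_rev // -subSn // subSS ?leq_subr // subKn // ltnW.
rewrite distrC -sq; apply: expsum_diff_le => //.
  move=> p /mapP[q /z1[q1 qe] ->] /=; rewrite normfV q1 invr1; split=> //.
  have q0 : q.2 != 0 by rewrite -normr_eq0 q1 oner_eq0.
  have -> : q.2^-1 - 1 = - q.2^-1 * (q.2 - 1) by rewrite mulrBr mulNr mulVf //; ring.
  by rewrite normrM normrN normfV q1 invr1 mul1r.
move=> l hl; rewrite sq in hl; rewrite expsum_rev //; last by lia.
by rewrite gB // leq_subr.
Qed.

(** Summation by parts: multiplying by [w - 1] telescopes the powers of [w], leaving two boundary
    terms and the variation of [F]. *)
Lemma abel_sum_le (w : C) (F : nat -> C) N : `|w| = 1 ->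
  `|w - 1| * `|\sum_(k < N.+1) w ^+ k * F k|
    <= `|F 0%N| + `|F N| + \sum_(k < N) `|F k.+1 - F k|.
Proof.
move=> w1; rewrite -normrM.
have -> : (w - 1) * \sum_(k < N.+1) w ^+ k * F k =
    w ^+ N.+1 * F N - F 0%N - \sum_(k < N) w ^+ k.+1 * (F k.+1 - F k).
  elim: N => [|N IHN]; first by rewrite big_ord_recr !big_ord0 /=; ring.
  by rewrite big_ord_recr mulrDr IHN [in RHS]big_ord_recr /= !exprS; ring.
apply: le_trans (ler_normB _ _) _; rewrite lerD //.
  by apply: le_trans (ler_normB _ _) _; rewrite normrM normrX w1 expr1n mul1r addrC.
apply: le_trans (ler_norm_sum _ _ _) _; apply: ler_sum => k _.
by rewrite normrM normrX w1 expr1n mul1r.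
Qed.

(** Dividing out the carriers [u ^+ k] and [v ^+ k] leaves slowly varying envelopes, so the inner
    product is an oscillating sum of ratio [u * v^*], to which [abel_sum_le] applies. The envelopes
    are bounded by the energies through [expsum_sup_window], and 2 A B <= A^2 + B^2 separates the
    two. *)
Lemma expsum_orth N m s ps qs u v eta : (0 < m)%N -> (2 * (s * m) <= N)%N ->
  (size ps <= s)%N -> (size qs <= s)%N -> `|u| = 1 -> `|v| = 1 -> 0 <= eta ->
  {in ps, forall p, `|p.2| = 1 /\ `|p.2 - u| <= eta} ->
  {in qs, forall p, `|p.2| = 1 /\ `|p.2 - v| <= eta} ->
  `|u - v| * `|\sum_(k < N.+1) expsum ps k * (expsum qs k)^*| <=
    (1 + N%:R * (3 ^+ s * (2 / m%:R + eta))) * (10 ^+ s / m%:R) *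
    (\sum_(k < N.+1) `|expsum ps k| ^+ 2 + \sum_(k < N.+1) `|expsum qs k| ^+ 2).
Proof.
move=> m0 sN sp sq u1 v1 eta0 zp zq.
have mV : 0 <= m%:R^-1 :> C by rewrite invr_ge0 ler0n.
pose d := 3 ^+ s * (2 / m%:R + eta); pose K : C := 10 ^+ s / m%:R.
have d0 : 0 <= d by rewrite mulr_ge0 ?exprn_ge0 ?addr_ge0 ?mulr_ge0.
have K0 : 0 <= K by rewrite mulr_ge0 ?exprn_ge0.
(* [B] is the sup bound given by the energy. Exponents are raised from [size rs] to [s] so that one
   [K] and one [d] serve both sums. *)
have demod (rs : seq (C * C)) r : `|r| = 1 -> (size rs <= s)%N ->
    {in rs, forall p, `|p.2| = 1 /\ `|p.2 - r| <= eta} ->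
    exists g : nat -> C, exists2 B : C, 0 <= B &
    [/\ forall k, expsum rs k = r ^+ k * g k,
        B ^+ 2 = K * \sum_(k < N.+1) `|expsum rs k| ^+ 2,
        forall k, (k <= N)%N -> `|g k| <= B &
        forall k, (k < N)%N -> `|g k.+1 - g k| <= d * B].
  move=> r1 srs zr; have r0 : r != 0 by rewrite -normr_eq0 r1 oner_eq0.
  pose rs' := [seq (p.1, r^-1 * p.2) | p <- rs].
  have srs' : size rs' = size rs by rewrite size_map.
  have sN' : (2 * (size rs' * m) <= N)%N.
    by apply: leq_trans sN; rewrite leq_mul2l /= leq_mul2r srs' srs orbT.
  have zr' : {in rs', forall p, `|p.2| = 1 /\ `|p.2 - 1| <= eta}.
    move=> p /mapP[q /zr[q1 qe] ->] /=; rewrite normrM normfV r1 q1 invr1 mul1r.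
    split=> //; rewrite -(mulVf r0) -mulrBr normrM normfV r1 invr1 mul1r //.
  have zr1 : {in rs', forall p, `|p.2| = 1} by move=> p /zr'[].
  have mod k : expsum rs k = r ^+ k * expsum rs' k.
    rewrite /expsum big_map mulr_sumr; apply: eq_bigr => p _ /=.
    by rewrite [RHS]mulrCA exprMn (mulrA (r ^+ k)) -exprMn mulfV // expr1n mul1r.
  have nmod k : `|expsum rs k| = `|expsum rs' k|.
    by rewrite mod normrM normrX r1 expr1n mul1r.
  pose E := \sum_(k < N.+1) `|expsum rs' k| ^+ 2.
  have E0 : 0 <= E by apply: sumr_ge0 => k _; rewrite exprn_ge0.
  have KE0 : 0 <= K * E by rewrite mulr_ge0.
  have gB k : (k <= N)%N -> `|expsum rs' k| <= sqrtC (K * E).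
    move=> kN; rewrite -(@ler_pXn2r _ 2) ?nnegrE ?sqrtC_ge0 // sqrtCK.
    apply: le_trans (expsum_sup_window m0 sN' zr1 kN) _.
    by rewrite ler_wpM2r // ler_wpM2r // ler_weXn2l ?ler1n // srs'.
  exists (expsum rs'), (sqrtC (K * E)); first by rewrite sqrtC_ge0.
  split=> //; first by rewrite sqrtCK; under [in RHS]eq_bigr do rewrite nmod.
  move=> k kN; apply: le_trans (expsum_diff_window m0 sN' eta0 zr' gB kN) _.
  rewrite [in leRHS]/d -[leRHS]mulrA ler_wpM2r ?ler_weXn2l ?ler1n ?srs' //.
  by rewrite mulr_ge0 ?sqrtC_ge0 // addr_ge0 ?mulr_ge0.
have [g [A A0 [pg A2 gA dgA]]] := demod ps u u1 sp zp.
have [f [B B0 [qf B2 fB dfB]]] := demod qs v v1 sq zq.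
have vV : v^* * v = 1 by rewrite mulrC -normCK v1 expr1n.
have -> : u - v = (u * v^* - 1) * v by rewrite mulrBl -mulrA vV mulr1 mul1r.
rewrite normrM v1 mulr1.
rewrite (eq_bigr (fun k : 'I_N.+1 => (u * v^*) ^+ k * (g k * (f k)^*))); last first.
  by move=> k _; rewrite pg qf rmorphM rmorphXn /= exprMn; ring.
apply: le_trans (abel_sum_le (fun k => g k * (f k)^*) N _) _.
  by rewrite normrM norm_conjC u1 v1 mulr1.
have gfB k : (k <= N)%N -> `|g k * (f k)^*| <= A * B.
  by move=> kN; rewrite normrM norm_conjC ler_pM ?gA ?fB.
have dgf (k : 'I_N) : `|g k.+1 * (f k.+1)^* - g k * (f k)^*| <= 2 * d * (A * B).
  have -> : g k.+1 * (f k.+1)^* - g k * (f k)^* =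
      (g k.+1 - g k) * (f k.+1)^* + g k * (f k.+1 - f k)^*.
    by rewrite rmorphB /=; ring.
  have -> : 2 * d * (A * B) = d * A * B + A * (d * B) by ring.
  apply: le_trans (ler_normD _ _) _; rewrite !normrM !norm_conjC.
  by rewrite lerD ?ler_pM ?dgA ?fB ?dfB ?gA // ltnW.
apply: (@le_trans _ _ (A * B + A * B + \sum_(k < N) 2 * d * (A * B))).
  by rewrite !lerD ?gfB // ler_sum // => k _; apply: dgf.
rewrite sumr_const card_ord -(mulr_natl (2 * d * (A * B)) N) -/d -/K -[leRHS]mulrA
  [K * (_ + _)]mulrDr -A2 -B2.
have -> : A * B + A * B + N%:R * (2 * d * (A * B)) =
    (1 + N%:R * d) * (2 * (A * B)) by ring.
rewrite ler_wpM2l //; last by have := norm_double_mul_le A B; rewrite !ger0_norm.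
by rewrite addr_ge0 // mulr_ge0 // ler0n.
Qed.

End ExponentialSums.

(** * The wrap-around distance *)

Section Expi.
Variable R : realType.
Implicit Types t u v x y : R.

Lemma expiD u v : expi (u + v) = expi u * expi v.
Proof. by rewrite /expi cosD sinD; simpc; congr (_ +i* _)%C; ring. Qed.

Lemma expi0 : expi 0 = 1 :> R[i]%C.
Proof. by rewrite /expi cos0 sin0. Qed.

Lemma expi_nat (k : nat) t : expi (k%:R * t) = expi t ^+ k.
Proof.
elim: k => [|k IHk]; first by rewrite mul0r expi0 expr0.
by rewrite -natr1 mulrDl mul1r expiD IHk exprSr.
Qed.

Lemma norm_expi t : `|expi t| = 1.
Proof. by rewrite normc_def /= cos2Dsin2 sqrtr1. Qed.

Lemma expiD2pi t : expi (t + pi *+ 2) = expi t.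
Proof. by rewrite /expi cosD2pi sinD2pi. Qed.

Lemma norm_expi_sub1 t : `|expi t - 1| = (2 * `|sin (t / 2)|)%:C%C.
Proof.
rewrite normc_def /=; congr (_ %:C)%C.
rewrite oppr0 addr0 -[RHS]ger0_norm ?mulr_ge0 // -sqrtr_sqr; congr Num.sqrt.
have -> : t = (t / 2) *+ 2 by rewrite -mulr_natr -mulrA mulVf ?mulr1 // pnatr_eq0.
rewrite -(mulr_natr (t / 2)) mulfK ?pnatr_eq0 // mulr_natr cos_mulr2n sin_mulr2n.
rewrite exprMn real_normK ?num_real //.
have h := cos2Dsin2 (t / 2); set c := cos _ in h *; set d := sin _ in h *.
have dd : d ^+ 2 = 1 - c ^+ 2 by rewrite -h; ring.
by rewrite -(mulr_natr (c * d)) !exprMn dd; ring.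
Qed.

Lemma sin_mvt v : 0 <= v -> exists2 c, c \in `[0, v] & sin v = cos c * v.
Proof.
move=> v0; have [|c cv] := @MVT_segment _ sin cos 0 v v0 (fun x _ => is_derive_sin x).
  by apply: continuous_subspaceT => z; exact: continuous_sin.
by rewrite sin0 !subr0 => e; exists c.
Qed.

Lemma norm_sin_le u : `|sin u| <= `|u|.
Proof.
wlog u0 : u / 0 <= u => [hw|].
  by have [/hw//|/ltW u0] := leP 0 u; rewrite -normrN -(normrN u) -sinN hw ?oppr_ge0.
have [c _ ->] := sin_mvt u0; rewrite normrM ler_piMl //; exact: cos_max.
Qed.

(** The doubling formula reduces to the angle [u / 2], at most pi / 4, where the cosine and the one
    produced by the mean value theorem are both at least 1 / 2. *)
Lemma norm_sin_ge u : `|u| <= pi / 2 -> `|u| / 4 <= `|sin u|.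
Proof.
wlog u0 : u / 0 <= u => [hw|].
  have [/hw//|/ltW u0] := leP 0 u; rewrite -normrN -(normrN (sin u)) -sinN.
  by apply/hw; rewrite oppr_ge0.
rewrite (ger0_norm u0) => u1.
have cos_half c : 0 <= c <= u / 2 -> 1 / 2 <= cos c.
  move=> /andP[c0 cu]; have pi0 := @pi_gt0 R.
  have cos2 : cos (c *+ 2) = cos c ^+ 2 * 2 - 1 by rewrite cos_mulr2n mulr_natr.
  have : 0 <= cos (c *+ 2) by apply: cos_ge0_pihalf; rewrite -mulr_natr; lra.
  have : 0 <= cos c by apply: cos_ge0_pihalf; lra.
  rewrite cos2; nra.
have [|c] := @sin_mvt (u / 2); first lra.
rewrite in_itv /= => cu sinu.
have := cos_half _ cu; have := cos_half (u / 2) => cv cc.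
have {}cv : 1 / 2 <= cos (u / 2) by apply: cv; lra.
apply: le_trans (ler_norm _).
rewrite [in sin _](_ : u = (u / 2) *+ 2); last by rewrite -mulr_natr; field.
rewrite sin_mulr2n sinu -(mulr_natr (_ * _)).
have ccv : 1 / 4 <= cos (u / 2) * cos c by nra.
have : (1 / 4) * u <= (cos (u / 2) * cos c) * u by rewrite ler_wpM2r.
lra.
Qed.

Lemma expi_sub1_le t : `|expi t - 1| <= `|t|%:C%C.
Proof.
rewrite norm_expi_sub1 lecR.
have := norm_sin_le (t / 2); rewrite normrM normfV normr_nat; lra.
Qed.

Lemma expi_sub1_ge t : `|t| <= pi -> (`|t| / 4)%:C%C <= `|expi t - 1|.
Proof.
move=> tpi; rewrite norm_expi_sub1 lecR.
have := @norm_sin_ge (t / 2); rewrite normrM normfV normr_nat; lra.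
Qed.

Lemma wrap_dist_expi x y : - pi < x <= pi -> - pi < y <= pi ->
  exists t, [/\ wrap_dist x y = `|t|, `|t| <= pi & expi t = expi (x - y)].
Proof.
move=> /andP[hx1 hx2] /andP[hy1 hy2]; have pi0 := @pi_gt0 R.
(* [Arg] is a choice with default 0, so the set must be shown nonempty. As [x - y] lies strictly
   between -2 pi and 2 pi, at most one shift by 2 pi is enough. *)
have [|] := @xgetPex _ 0
    [set t | - pi < t <= pi /\ expi (x - y) = `|expi (x - y)| * expi t]%classic.
  rewrite /= norm_expi; have [h1|h1] := leP (x - y) (- pi).
    exists (x - y + pi *+ 2); rewrite expiD2pi mul1r mulr2n; split=> //.
    by apply/andP; split; lra.
  have [h2|h2] := leP (x - y) pi; first by exists (x - y); rewrite mul1r h1 h2.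
  exists (x - y - pi *+ 2); rewrite mul1r -[in LHS](subrK (pi *+ 2) (x - y)) expiD2pi.
  by split=> //; rewrite mulr2n; apply/andP; split; lra.
rewrite -/(Arg _) norm_expi mul1r => /andP[t1 t2] ->.
exists (Arg (expi (x - y))); split=> //.
by rewrite ler_norml t2 andbT ltW.
Qed.

End Expi.

(** * Min-max comparison *)

Section MinMax.
Variable R : realType.
Local Notation C := (R[i]%C).

Lemma common_kernel n (fs : seq 'rV[C]_n) : (size fs < n)%N ->
  exists2 x : 'cV[C]_n, x != 0 & {in fs, forall f, f *m x = 0}.
Proof.
move=> fsn; pose A := \matrix_(i < size fs) fs`_i.
have : cokermx A != 0.
  by rewrite -mxrank_eq0 mxrank_coker subn_eq0 -ltnNge (leq_ltn_trans (rank_leq_row _)).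
rewrite -trmx_eq0 => /rowV0Pn[v /submxP[D ->] nz]; exists (D *m (cokermx A)^T)^T.
  by rewrite trmx_eq0.
move=> f /(nthP 0)[i ifs <-].
have -> : fs`_i = row (Ordinal ifs) A by rewrite rowK.
by rewrite trmx_mul trmxK mulmxA -row_mul mulmx_coker row0 mul0mx.
Qed.

(** Only entries after position [j] of the sorted list can be strictly smaller than the [j]-th.
    Together with [count_gt_nth_sort] this bounds the number of forms killed in the min-max argument
    by n - 1, ties included. *)
Lemma count_lt_nth_sort (s : seq R) j : (j < size s)%N ->
  (count (fun y : R => y < (sort >=%R s)`_j)%R s <= size s - j.+1)%N.
Proof.
move=> js; rewrite -(count_sort >=%R); set t := sort _ _.
have st : size t = size s by rewrite size_sort.
have sorted_t : sorted >=%R t by apply: sort_sorted; exact: ge_total.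
rewrite -[X in count _ X](cat_take_drop j.+1 t) count_cat.
have -> : count (fun y : R => y < t`_j) (take j.+1 t) = 0%N.
  apply/eqP; rewrite -leqn0 leqNgt -has_count; apply/hasPn => y /(nthP 0)[k].
  rewrite size_takel ?st // => kj <-; rewrite nth_take // -leNgt.
  apply: (sorted_leq_nth ge_trans ge_refl 0 sorted_t); rewrite ?inE ?st //.
  exact: leq_ltn_trans js.
by rewrite add0n -st -size_drop count_size.
Qed.

Lemma count_gt_nth_sort (s : seq R) j :
  (count (fun y : R => (sort >=%R s)`_j < y)%R s <= j)%N.
Proof.
rewrite -(count_sort >=%R); set t := sort _ _.
have sorted_t : sorted >=%R t by apply: sort_sorted; exact: ge_total.
rewrite -[X in count _ X](cat_take_drop j t) count_cat.
have -> : count (fun y : R => t`_j < y) (drop j t) = 0%N.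
  apply/eqP; rewrite -leqn0 leqNgt -has_count; apply/hasPn => y /(nthP 0)[k].
  rewrite size_drop => kj <-; rewrite nth_drop -leNgt.
  apply: (sorted_leq_nth ge_trans ge_refl 0 sorted_t); rewrite ?inE ?leq_addr //.
    by rewrite (leq_ltn_trans (leq_addr k j)) // -ltn_subRL.
  by rewrite -ltn_subRL.
by rewrite addn0 (leq_trans (count_size _ _)) // size_take; case: ltnP.
Qed.

Definition sqnorm n (x : 'cV[C]_n) : C := \sum_i `|x i 0| ^+ 2.

(** Parseval and the diagonal form of [Q], kept as a list of weighted linear forms rather than as a
    matrix, so that the lists of several clusters can be concatenated. *)
Definition diagonalizes n (D : seq ('rV[C]_n * R)) (Q : 'cV[C]_n -> C) : Prop :=
  forall x, sqnorm x = \sum_(p <- D) `|(p.1 *m x) 0 0| ^+ 2 /\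
            Q x = \sum_(p <- D) p.2%:C%C * `|(p.1 *m x) 0 0| ^+ 2.

Lemma sqnorm_gt0 n (x : 'cV[C]_n) : x != 0 -> 0 < sqnorm x.
Proof.
move=> x0; rewrite lt0r sumr_ge0 ?andbT; last by move=> i _; rewrite exprn_ge0.
apply: contra x0; rewrite psumr_eq0; last by move=> i _; rewrite exprn_ge0.
move=> /allP h; apply/eqP/colP => i; rewrite mxE; apply/eqP.
by have := h i (mem_index_enum _); rewrite expf_eq0 normr_eq0.
Qed.

(* Courant-Fischer: a nonzero vector killed by the coordinates of [D] below the
   j-th singular value and by those of [D'] above it compares the two values. *)
Lemma sorted_sqrt_le n (D D' : seq ('rV[C]_n * R)) (Q Q' : 'cV[C]_n -> C) (c : R) :
  diagonalizes D Q -> diagonalizes D' Q' -> size D = n -> 0 <= c ->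
  (forall x, Q x <= c%:C%C * Q' x) -> forall j, (j < n)%N ->
  (sort >=%R [seq Num.sqrt p.2 | p <- D])`_j <=
  Num.sqrt c * (sort >=%R [seq Num.sqrt p.2 | p <- D'])`_j.
Proof.
move=> dQ dQ' sD c0 leQ j jn.
have js : (j < size [seq Num.sqrt p.2 | p <- D])%N by rewrite size_map sD.
have := count_lt_nth_sort js.
have := count_gt_nth_sort [seq Num.sqrt p.2 | p <- D'] j.
(* Past the end of the list the entry is the default 0. *)
have : 0 <= (sort >=%R [seq Num.sqrt p.2 | p <- D'])`_j.
  set s := sort _ _; have [jt|jt] := ltnP j (size s); last by rewrite nth_default.
  by have := mem_nth 0 jt; rewrite mem_sort => /mapP[p _ ->]; exact: sqrtr_ge0.
set a := (sort _ [seq _ | _ <- D])`_j; set b := (sort _ [seq _ | _ <- D'])`_j.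
rewrite !count_map size_map sD => b0 cb ca; rewrite leNgt; apply/negP => ab.
have a0 : 0 < a by apply: le_lt_trans ab; rewrite mulr_ge0 ?sqrtr_ge0.
(* At most (n - j - 1) + j forms, fewer than [n], so a nonzero vector is killed by all of them. *)
have [|x x0 killx] := @common_kernel n
    (map fst [seq p <- D | Num.sqrt p.2 < a] ++ map fst [seq p <- D' | b < Num.sqrt p.2]).
  rewrite size_cat !size_map !size_filter; apply: leq_ltn_trans (leq_add ca cb) _.
  by move: jn; clear; lia.
have [nx Qx] := dQ x; have [nx' Qx'] := dQ' x.
have lower : (a ^+ 2)%:C%C * sqnorm x <= Q x.
  rewrite nx Qx mulr_sumr !big_seq; apply: ler_sum => p pD.
  have [pa|ap] := ltP (Num.sqrt p.2) a.
    rewrite killx ?mxE ?normr0 ?expr0n ?mulr0 //.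
    by rewrite mem_cat map_f // mem_filter pa pD.
  have p0 : 0 < p.2 by rewrite -sqrtr_gt0 (lt_le_trans a0).
  rewrite ler_wpM2r ?exprn_ge0 // lecR -[leRHS](sqr_sqrtr (ltW p0)).
  by rewrite ler_pXn2r ?nnegrE ?sqrtr_ge0 // ltW.
have upper : Q' x <= (b ^+ 2)%:C%C * sqnorm x.
  rewrite nx' Qx' mulr_sumr !big_seq; apply: ler_sum => p pD.
  have [pb|bp] := ltP b (Num.sqrt p.2).
    rewrite killx ?mxE ?normr0 ?expr0n ?mulr0 //.
    by rewrite mem_cat orbC map_f // mem_filter pb pD.
  rewrite ler_wpM2r ?exprn_ge0 // lecR.
  (* A negative weight is hidden by [Num.sqrt], but it is below [b ^+ 2] anyway. *)
  have [p0|/ltW p0] := leP 0 p.2; last by rewrite (le_trans p0) ?exprn_ge0.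
  by rewrite -[leLHS](sqr_sqrtr p0) ler_pXn2r ?nnegrE ?sqrtr_ge0.
have : (a ^+ 2)%:C%C * sqnorm x <= (c * b ^+ 2)%:C%C * sqnorm x.
  apply: le_trans lower (le_trans (leQ x) _).
  by rewrite rmorphM /= -mulrA ler_wpM2l // lecR.
rewrite ler_pM2r ?sqnorm_gt0 // lecR leNgt => /negP; apply.
rewrite -[c]sqr_sqrtr // -exprMn ltr_pXn2r ?nnegrE ?(ltW a0) ?mulr_ge0 ?sqrtr_ge0 //.
Qed.

Definition gram_basis m n (A : 'M[C]_(m, n)) (G := A ^t* *m A) : seq ('rV[C]_n * R) :=
  [seq (row i (spectralmx G), complex.Re (spectral_diag G 0 i)) | i : 'I_n].

Lemma singular_values_gram_basis m n (A : 'M[C]_(m, n)) :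
  singular_values A = sort >=%R [seq Num.sqrt p.2 | p <- gram_basis A].
Proof. by rewrite /singular_values /gram_basis -map_comp. Qed.

(** Spectral theorem for the Hermitian matrix [G]: its eigenvector matrix is unitary, which gives
    Parseval, and its eigenvalues are real, so taking [Re] loses nothing. *)
Lemma gram_diagonalizes m n (A : 'M[C]_(m, n)) :
  diagonalizes (gram_basis A) (fun x => sqnorm (A *m x)).
Proof.
rewrite /gram_basis; set G := A ^t* *m A.
have sqnormE k (x : 'cV[C]_k) : sqnorm x = (x ^t* *m x) 0 0.
  rewrite mxE; apply: eq_bigr => i _; rewrite !mxE normCK mulrC //.
have hG : G \is hermsymmx.
  apply/is_hermitianmxP; rewrite expr0 scale1r /G.
  by rewrite trmx_mul map_mxM trmxCK.
have /orthomx_spectralP := hermitian_normalmx hG.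
have /mxOverP realG := hermitian_spectral_diag_real hG.
have uP := spectral_unitarymx G.
rewrite (invmx_unitary uP); set P := spectralmx G; set d := spectral_diag G => defG x.
rewrite !big_image /=.
have rowE i : (row i P *m x) 0 0 = (P *m x) i 0 by rewrite -row_mul mxE.
split.
  rewrite sqnormE; transitivity (sqnorm (P *m x)).
    rewrite sqnormE trmx_mul map_mxM -mulmxA (mulmxA (P ^t*)).
    by rewrite -(invmx_unitary uP) mulVmx ?mul1mx // unitarymx_unit.
  by apply: eq_bigr => i _; rewrite rowE.
rewrite sqnormE trmx_mul map_mxM -mulmxA (mulmxA (A ^t*)) -/G [in LHS]defG.
rewrite -!mulmxA mulmxA -map_mxM -trmx_mul mxE; apply: eq_bigr => i _.
rewrite rowE mul_diag_mx !mxE normCK mulrCA [X in _ = _ * X]mulrC; congr (_ * _).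
by rewrite -[LHS]RRe_real.
Qed.

End MinMax.

(** * Clusters *)

(** After expansion of the square the diagonal terms cancel against the energies. Each pair costs at
    most [e * (E i + E j)], and summing over all pairs counts every energy 2 M times. *)
Lemma energy_sum_le (F : numClosedFieldType) M N (f : 'I_M -> nat -> F) (e : F) :
  let E i := \sum_(k < N.+1) `|f i k| ^+ 2 in
  0 <= e ->
  (forall i j, i != j ->
     `|\sum_(k < N.+1) f i k * (f j k)^*| <= e * (E i + E j)) ->
  `|\sum_(k < N.+1) `|\sum_i f i k| ^+ 2 - \sum_i E i| <= 2 * M%:R * e * \sum_i E i.
Proof.
move=> E e0 orth.
have E0 i : 0 <= E i by apply: sumr_ge0 => k _; rewrite exprn_ge0.
pose G i j := \sum_(k < N.+1) f i k * (f j k)^*.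
have -> : \sum_(k < N.+1) `|\sum_i f i k| ^+ 2 = \sum_i \sum_j G i j.
  rewrite /G; under [RHS]eq_bigr do rewrite exchange_big /=.
  rewrite [RHS]exchange_big /=; apply: eq_bigr => k _.
  rewrite normCK rmorph_sum mulr_suml; apply: eq_bigr => i _.
  by rewrite mulr_sumr.
rewrite -sumrB; apply: le_trans (ler_norm_sum _ _ _) _.
have -> : 2 * M%:R * e * \sum_i E i = \sum_i \sum_j e * (E i + E j).
  under [RHS]eq_bigr do rewrite -mulr_sumr big_split /= sumr_const card_ord.
  rewrite -mulr_sumr big_split /= sumr_const card_ord sumrMnl.
  by rewrite -!(mulr_natl (\sum_i E i) M); ring.
apply: ler_sum => i _; rewrite (bigD1 i) //= [leRHS](bigD1 i) //=.
have -> : G i i = E i by apply: eq_bigr => k _; rewrite normCK.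
rewrite addrAC subrr add0r; apply: le_trans (ler_norm_sum _ _ _) _.
rewrite -[leLHS]add0r lerD ?mulr_ge0 ?addr_ge0 //.
by apply: ler_sum => j ji; rewrite orth // eq_sym.
Qed.

Section Clusters.
Variable R : realType.
Local Notation C := (R[i]%C).
Implicit Types (x y theta h : R) (Z : seq R) (c : R -> C).

Lemma dist_expi x y : - pi < x <= pi -> - pi < y <= pi ->
  (wrap_dist x y / 4)%:C%C <= `|expi x - expi y| <= (wrap_dist x y)%:C%C.
Proof.
move=> hx hy; have [t [-> tpi et]] := wrap_dist_expi hx hy.
have -> : expi x - expi y = (expi t - 1) * expi y.
  by rewrite et mulrBl -expiD subrK mul1r.
by rewrite normrM norm_expi mulr1 expi_sub1_ge // expi_sub1_le.
Qed.

Lemma wrap_dist_le_pi x y : - pi < x <= pi -> - pi < y <= pi -> wrap_dist x y <= pi.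
Proof. by move=> hx hy; have [t [-> ]] := wrap_dist_expi hx hy. Qed.

(** The coefficients are a function of the node, not of its position, so the same [c] serves [X] and
    each of its clusters. *)
Definition node_sum c Z : nat -> C := expsum [seq (c y, expi y) | y <- Z].

(* The averaging windows have length m >= N / (4 S), and nodes of distinct
   clusters satisfy |expi x - expi y| >= theta / 4. *)
Definition orth_const (S : nat) : R :=
  16 * S%:R * 10 ^+ S * (1 + 3 ^+ S * (8 * S%:R + 1)).

Lemma exists_window_length (S N : nat) : (0 < S)%N -> (2 * S <= N)%N ->
  exists m, [/\ (0 < m)%N, (2 * (S * m) <= N)%N & (N <= 4 * (S * m))%N].
Proof.
move=> S0 SN; have S20 : (0 < 2 * S)%N by rewrite muln_gt0.
have m0 : (0 < N %/ (2 * S))%N by rewrite divn_gt0.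
(* Being at least 1, this floor is more than half of N / (2 S). *)
exists (N %/ (2 * S))%N; split=> //; first by rewrite mulnA mulnC leq_divM.
by have := ltn_ceil N S20; nia.
Qed.

(** Instance of [expsum_orth] whose carriers are the first nodes of the two clusters, with [eta] the
    bound [h], since chords are at most arcs. The carriers are at least theta / 4 apart, and 1 / m
    is O(1 / N); this gives the factor 1 / (N theta). *)
Lemma node_sum_orth (N S : nat) theta h Z Z' c : (0 < S)%N ->
  {in Z, forall x, - pi < x <= pi} -> {in Z', forall x, - pi < x <= pi} ->
  (0 < size Z <= S)%N -> (0 < size Z' <= S)%N ->
  {in Z &, forall x y, x != y -> wrap_dist x y <= h} ->
  {in Z' &, forall x y, x != y -> wrap_dist x y <= h} ->
  0 < theta -> {in Z & Z', forall x y, theta <= wrap_dist x y} ->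
  0 <= h -> N%:R * h <= 1 -> 8 * S%:R / theta <= N%:R ->
  `|\sum_(k < N.+1) node_sum c Z k * (node_sum c Z' k)^*| <=
  (orth_const S / (N%:R * theta))%:C%C *
  (\sum_(k < N.+1) `|node_sum c Z k| ^+ 2 + \sum_(k < N.+1) `|node_sum c Z' k| ^+ 2).
Proof.
move=> S0 rZ rZ' /andP[Z0 ZS] /andP[Z0' ZS'] cl cl' t0 sep h0 Nh Nt.
pose x := nth 0 Z 0; pose y := nth 0 Z' 0.
have xZ : x \in Z by rewrite mem_nth.
have yZ : y \in Z' by rewrite mem_nth.
(* Two nodes are at distance at most pi < 4. With 8 S / theta <= N this yields 2 S <= N, the room
   needed for the windows. *)
have tpi : theta <= 4.
  apply: le_trans (sep _ _ xZ yZ) _.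
  apply: le_trans (wrap_dist_le_pi (rZ _ xZ) (rZ' _ yZ)) _.
  by have := @pihalf_lt2 R; lra.
have SR : 0 < S%:R :> R by rewrite ltr0n.
have NS : (2 * S <= N)%N.
  rewrite -(ler_nat R) natrM; apply: le_trans Nt.
  by rewrite ler_pdivlMr //; nra.
have [m [m0 mN Nm]] := exists_window_length S0 NS.
have NR : 0 < N%:R :> R.
  by rewrite ltr0n (leq_trans _ NS) // muln_gt0.
have mR : m%:R^-1 <= 4 * S%:R / N%:R :> R.
  rewrite -[m%:R^-1]div1r ler_pdivrMr ?ltr0n // mulrAC ler_pdivlMr // mul1r.
  by rewrite -!natrM ler_nat -mulnA.
have bnd (T : seq R) z : {in T, forall x, - pi < x <= pi} -> z \in T ->
    {in T &, forall x y, x != y -> wrap_dist x y <= h} ->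
    {in [seq (c y, expi y) | y <- T],
      forall p, `|p.2| = 1 /\ `|p.2 - expi z| <= h%:C%C}.
  move=> rT zT clT p /mapP[w wT ->] /=; rewrite norm_expi; split=> //.
  have [->|wz] := eqVneq w z; first by rewrite subrr normr0 lecR.
  have /andP[_ d] := dist_expi (rT _ wT) (rT _ zT).
  by apply: le_trans d _; rewrite lecR clT.
have hC : 0 <= h%:C%C :> C by rewrite lecR.
have := @expsum_orth _ N m S [seq (c y, expi y) | y <- Z]
  [seq (c y, expi y) | y <- Z'] (expi x) (expi y) h%:C%C m0 mN.
rewrite !size_map !norm_expi.
move=> /(_ ZS ZS' erefl erefl hC (bnd _ _ rZ xZ cl) (bnd _ _ rZ' yZ cl')).
rewrite -/(node_sum c Z) -/(node_sum c Z').
set E := \sum_(k < N.+1) `|node_sum c Z k| ^+ 2.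
set E' := \sum_(k < N.+1) `|node_sum c Z' k| ^+ 2.
set G := \sum_(k < N.+1) _.
have EE0 : 0 <= E + E'.
  by apply: addr_ge0; apply: sumr_ge0 => k _; rewrite exprn_ge0.
have -> : (1 + N%:R * (3 ^+ S * (2 / m%:R + h%:C%C))) * (10 ^+ S / m%:R) =
   ((1 + N%:R * (3 ^+ S * (2 / m%:R + h))) * (10 ^+ S / m%:R))%:C%C :> C.
  by rewrite !(rmorphM, rmorphD, fmorphV, rmorphXn, rmorph_nat, rmorph1) /=.
move=> orth.
have duv : (theta / 4)%:C%C <= `|expi x - expi y|.
  have /andP[d _] := dist_expi (rZ _ xZ) (rZ' _ yZ).
  by apply: le_trans d; rewrite lecR ler_pM2r ?invr_gt0 ?sep.
have t40 : 0 < (theta / 4)%:C%C :> C by rewrite ltcR divr_gt0.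
rewrite -(ler_pM2l t40).
apply: (@le_trans _ _ (`|expi x - expi y| * `|G|)); first by rewrite ler_wpM2r.
apply: le_trans orth _; rewrite [leRHS]mulrA ler_wpM2r // -rmorphM lecR /=.
have -> : theta / 4 * (orth_const S / (N%:R * theta)) =
    (1 + 3 ^+ S * (8 * S%:R + 1)) * (10 ^+ S * (4 * S%:R / N%:R)).
  by rewrite /orth_const; field; rewrite !gt_eqF.
have m0R : 0 <= m%:R^-1 :> R by rewrite invr_ge0.
have p3 : 0 <= 3 ^+ S :> R by rewrite exprn_ge0.
apply: ler_pM.
- by rewrite addr_ge0 // !mulr_ge0 // addr_ge0 // mulr_ge0.
- by rewrite mulr_ge0 // exprn_ge0.
(* N (2 / m + h) <= 8 S + 1, from 1 / m <= 4 S / N and N h <= 1. *)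
- rewrite lerD2l mulrCA ler_wpM2l // mulrDr lerD //.
  have -> : 8 * S%:R = N%:R * (2 * (4 * S%:R / N%:R)) :> R by field; rewrite gt_eqF.
  by rewrite !ler_wpM2l // ltW.
- by rewrite ler_wpM2l // exprn_ge0.
Qed.

Lemma vandermonde_mul N Z c (k : 'I_N.+1) :
  (vandermonde N Z *m \col_i c Z`_i) k 0 = node_sum c Z k.
Proof.
rewrite mxE /node_sum /expsum big_map (big_nth 0) big_mkord.
by apply: eq_bigr => i _; rewrite !mxE expi_nat mulrC.
Qed.

Lemma sqnorm_vandermonde N Z c :
  sqnorm (vandermonde N Z *m \col_i c Z`_i) = \sum_(k < N.+1) `|node_sum c Z k| ^+ 2.
Proof. by apply: eq_bigr => k _; rewrite vandermonde_mul. Qed.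

Lemma sqnorm_col Z c : sqnorm (\col_(i < size Z) c Z`_i) = \sum_(y <- Z) `|c y| ^+ 2.
Proof. by rewrite (big_nth 0) big_mkord; apply: eq_bigr => i _; rewrite mxE. Qed.

(** Stated for any commutative law because it splits complex sums as well as the count of the
    nodes. *)
Lemma big_partition (T : Type) (idx : T) (op : Monoid.com_law idx) M X
    (P : 'I_M -> seq R) (F : R -> T) :
  uniq X -> (forall j, uniq (P j)) ->
  (forall x, (x \in X) = [exists j, x \in P j]) ->
  (forall (i j : 'I_M) x, x \in P i -> x \in P j -> i = j) ->
  \big[op/idx]_(y <- X) F y = \big[op/idx]_j \big[op/idx]_(y <- P j) F y.
Proof.
move=> uX uP XP dP.
have -> : \big[op/idx]_j \big[op/idx]_(y <- P j) F y =
    \big[op/idx]_j \big[op/idx]_(y <- X | y \in P j) F y.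
  apply: eq_bigr => j _; rewrite -[RHS]big_filter; apply: perm_big.
  apply: uniq_perm; rewrite ?filter_uniq // => y; rewrite mem_filter XP.
  by case yj: (y \in P j) => //=; apply/esym/existsP; exists j.
rewrite (exchange_big_dep predT) //= !big_seq; apply: eq_bigr => y.
rewrite XP => /existsP[j yj]; rewrite (big_pred1 j) // => i.
by apply/idP/eqP => [yi|->//]; exact: dP yi yj.
Qed.

End Clusters.

(** * The eigenbasis assembled from the clusters *)

Section ClusterBasis.
Variables (R : realType) (M N : nat) (X : seq R) (P : 'I_M -> seq R).
Local Notation C := (R[i]%C).

(** Nodes are matched by value because each cluster carries its own ordering. *)
Definition restriction_mx j : 'M[C]_(size (P j), size X) :=
  \matrix_(i, k) (X`_k == (P j)`_i)%:R.

(** When the [P j] partition [X], these are, up to the order of coordinates, the eigenvectors of the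
    block-diagonal matrix whose blocks are the Gram matrices of the clusters, each extended by zero
    to [X]. *)
Definition cluster_basis : seq ('rV[C]_(size X) * R) :=
  flatten [seq [seq (p.1 *m restriction_mx j, p.2)
               | p <- gram_basis (vandermonde N (P j))] | j <- enum 'I_M].

Lemma size_cluster_basis : size cluster_basis = (\sum_j size (P j))%N.
Proof.
rewrite size_flatten /shape -map_comp sumnE big_map big_enum /=.
by apply: eq_bigr => j _; rewrite size_map size_image card_ord.
Qed.

Lemma cluster_singular_values_basis :
  cluster_singular_values N P = sort >=%R [seq Num.sqrt p.2 | p <- cluster_basis].
Proof.
apply/perm_sortP; [exact: ge_total | exact: ge_trans | exact: ge_anti |].
rewrite map_flatten -map_comp; apply/permP => a.
rewrite !count_flatten -!map_comp; congr (sumn _); apply: eq_map => j /=.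
by rewrite singular_values_gram_basis count_sort -map_comp.
Qed.

Hypothesis uX : uniq X.
Hypothesis uP : forall j, uniq (P j).
Hypothesis XP : forall x, (x \in X) = [exists j, x \in P j].
Hypothesis dP : forall (i j : 'I_M) x, x \in P i -> x \in P j -> i = j.

(** Coordinates read as a function on the line, zero off [X], in the form that [node_sum] takes. *)
Definition value_at (x : 'cV[C]_(size X)) (y : R) : C :=
  \sum_(k < size X) (X`_k == y)%:R * x k 0.

Lemma value_at_col x : x = \col_i value_at x X`_i.
Proof.
apply/colP => i; rewrite mxE /value_at (bigD1 i) //= eqxx mul1r big1 ?addr0 // => k ki.
by rewrite nth_uniq // (inj_eq val_inj) (negPf ki) mul0r.
Qed.

Lemma restriction_mx_col j x : restriction_mx j *m x = \col_i value_at x (P j)`_i.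
Proof. by apply/colP => i; rewrite !mxE; apply: eq_bigr => k _; rewrite mxE. Qed.

(** The squared norm splits over the partition, and inside each cluster [gram_diagonalizes]
    applies. *)
Lemma cluster_basis_diagonalizes : diagonalizes cluster_basis
  (fun x => \sum_j sqnorm (vandermonde N (P j) *m (restriction_mx j *m x))).
Proof.
move=> x; rewrite /cluster_basis !big_flatten !big_map /=.
split; last first.
  apply: eq_bigr => j _.
  have [_ ->] := gram_diagonalizes (vandermonde N (P j)) (restriction_mx j *m x).
  by rewrite !big_map; apply: eq_bigr => i _ /=; rewrite mulmxA.
rewrite [in LHS](value_at_col x) sqnorm_col (big_partition _ _ uX uP XP dP).
apply: eq_bigr => j _; rewrite -sqnorm_col -restriction_mx_col.
have [-> _] := gram_diagonalizes (vandermonde N (P j)) (restriction_mx j *m x).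
by rewrite !big_map; apply: eq_bigr => i _ /=; rewrite mulmxA.
Qed.

End ClusterBasis.

(** * Comparison of the singular values *)

Theorem theorem2p2 (R : realType) (M : nat) (s : 'I_M -> nat) :
  (0 < M)%N -> (forall j, (0 < s j)%N) ->
  exists C5 C6 C7 C8 : R,
    [/\ 0 < C5, 0 < C6, 0 < C7 & 0 < C8] /\
    forall (h : 'I_M -> R) (theta : R) (X : seq R) (C : 'I_M -> seq R),
    clustered_configuration h s theta X C ->
    forall (N : nat) (hmax := \big[Num.max/0]_(j < M) h j)
      (sigma := singular_values (vandermonde N X))
      (sigmat := cluster_singular_values N C),
    (size X <= N.+1)%N ->
    C5 / theta <= N%:R <= C6 / hmax ->
    0 <= 1 - C7 / (N%:R * theta) - C8 * N%:R * hmax /\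
    forall j : nat, (j < size X)%N ->
      Num.sqrt (1 - C7 / (N%:R * theta) - C8 * N%:R * hmax) * sigmat`_j
        <= sigma`_j
        <= Num.sqrt (1 + C7 / (N%:R * theta) + C8 * N%:R * hmax) * sigmat`_j.
Proof.
move=> M0 s0.
pose S := (\sum_j s j)%N; pose kappa : R := orth_const R S.
have sS j : (s j <= S)%N by rewrite /S (bigD1 j) //= leq_addr.
have S0 : (0 < S)%N by apply: leq_trans (sS (Ordinal M0)).
have SR : 0 < S%:R :> R by rewrite ltr0n.
have MR : 0 < M%:R :> R by rewrite ltr0n.
have k0 : 0 < kappa.
  by rewrite /kappa /orth_const !mulr_gt0 ?exprn_gt0.
(* The factor 2 M comes from [energy_sum_le], applied with the pairwise bound kappa / (N theta). *)
pose C7 := 2 * M%:R * kappa.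
have C70 : 0 < C7 by rewrite !mulr_gt0.
(* In C5, the part 4 C7 gives eps <= 1 / 4 and the part 8 S is the condition of [node_sum_orth]. C6
   = 1 / 2 gives N h <= 1 / 2, so 1 - eps - N h is at least 1 / 4. *)
exists (4 * C7 + 8 * S%:R), (1 / 2), C7, 1; split.
  by split=> //; rewrite ?divr_gt0 ?addr_gt0 ?mulr_gt0.
move=> h theta X P [[uX rX] XP dP cl [t0 sep]] N hmax sigma sigmat sX /andP[N1 N2].
have h_le j : h j <= hmax by exact: le_bigmax.
have hmax0 : 0 < hmax.
  by have [hj _ _ _] := cl (Ordinal M0); apply: lt_le_trans hj (h_le _).
have NR : 0 < N%:R :> R.
  by apply: lt_le_trans N1; rewrite divr_gt0 ?addr_gt0 ?mulr_gt0.
have Nh : N%:R * hmax <= 1 / 2 by rewrite -ler_pdivlMr.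
have NtR : 4 * C7 + 8 * S%:R <= N%:R * theta by rewrite -ler_pdivrMr.
have Nt0 : 0 < N%:R * theta by rewrite mulr_gt0.
pose eps := C7 / (N%:R * theta).
have eps0 : 0 <= eps by rewrite divr_ge0 // ltW.
have eps_le : eps <= 1 / 4 by rewrite ler_pdivrMr //; lra.
have Nh0 : 0 <= N%:R * hmax by rewrite ltW // mulr_gt0.
rewrite -/eps !mul1r; split; first lra.
have uP j : uniq (P j) by have [_ []] := cl j.
have szP j : size (P j) = s j by have [] := cl j.
have PX j y : y \in P j -> y \in X by move=> yj; rewrite XP; apply/existsP; exists j.
have rP j : {in P j, forall x, - pi < x <= pi} by move=> y /PX /rX.
(* The sum over [X] is the superposition of the cluster sums, pairwise almost orthogonal by
   [node_sum_orth]. *)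
have energy c : `|\sum_(k < N.+1) `|node_sum c X k| ^+ 2
      - \sum_j \sum_(k < N.+1) `|node_sum c (P j) k| ^+ 2| <=
    eps%:C%C * \sum_j \sum_(k < N.+1) `|node_sum c (P j) k| ^+ 2.
  have -> : eps%:C%C = 2 * M%:R * (kappa / (N%:R * theta))%:C%C.
    by rewrite /eps /C7 -!mulrA !rmorphM /= !rmorph_nat.
  under eq_bigr => k _.
    rewrite (_ : node_sum c X k = \sum_j node_sum c (P j) k); last first.
      rewrite /node_sum /expsum big_map (big_partition _ _ uX uP XP dP).
      by apply: eq_bigr => j _; rewrite big_map.
    over.
  apply: (energy_sum_le (f := fun j => node_sum c (P j))).
    by rewrite lecR divr_ge0 // ltW.
  move=> i j ij; have cl_le l : {in P l &, forall x y, x != y -> wrap_dist x y <= hmax}.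
    move=> x y xl yl xy; have [_ _ _ /(_ x y xl yl xy) /andP[_ d]] := cl l.
    exact: le_trans d (h_le l).
  apply: (@node_sum_orth _ N S theta hmax) => //.
  - by rewrite szP s0 sS.
  - by rewrite szP s0 sS.
  - move=> x y xi yj; apply: (sep i) => //; first exact: PX yj.
    by apply: contra ij => yi; apply/eqP; exact: dP yi yj.
  - by rewrite ltW.
  - by apply: le_trans Nh _; lra.
  - by rewrite ler_pdivrMr //; lra.
pose Q x := sqnorm (vandermonde N X *m x).
pose Q' x := \sum_j sqnorm (vandermonde N (P j) *m (restriction_mx X P j *m x)).
have Q'0 x : 0 <= Q' x.
  by apply: sumr_ge0 => j _; apply: sumr_ge0 => k _; rewrite exprn_ge0.
have QQ' x : `|Q x - Q' x| <= eps%:C%C * Q' x.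
  have := energy (value_at x); rewrite -sqnorm_vandermonde -(value_at_col uX x).
  rewrite /Q' [in X in _ -> X](eq_bigr (fun j =>
    \sum_(k < N.+1) `|node_sum (value_at x) (P j) k| ^+ 2)) // => j _.
  by rewrite restriction_mx_col sqnorm_vandermonde.
(* The nonnegative term N h is added to reach the form of the stated factors. *)
pose delta := eps + N%:R * hmax.
have QQd x : `|Q x - Q' x| <= delta%:C%C * Q' x.
  by apply: le_trans (QQ' x) _; rewrite ler_wpM2r // lecR lerDl.
(* In the order on complex numbers a norm bound gives one-sided bounds only for real elements. *)
have Qreal x : Q x - Q' x \is Num.real.
  by rewrite rpredB ?ger0_real // sumr_ge0 // => k _; rewrite exprn_ge0.
have upper x : Q x <= (1 + delta)%:C%C * Q' x.
  rewrite rmorphD rmorph1 mulrDl mul1r -lerBlDl.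
  exact: le_trans (real_ler_norm (Qreal x)) (QQd x).
have lower x : (1 - delta)%:C%C * Q' x <= Q x.
  rewrite rmorphB rmorph1 mulrBl mul1r lerBlDl -lerBlDr -opprB.
  by apply: le_trans (real_ler_norm _) _; rewrite ?rpredN // normrN.
have dd : 0 < 1 - delta by rewrite /delta; lra.
have dX := gram_diagonalizes (vandermonde N X).
have dP' := @cluster_basis_diagonalizes R M N X P uX uP XP dP.
have size_basis : size (cluster_basis N X P) = size X.
  rewrite size_cluster_basis -sum1_size (big_partition _ _ uX uP XP dP).
  by apply: eq_bigr => j _; rewrite sum1_size.
have -> : 1 + eps + N%:R * hmax = 1 + delta by rewrite addrA.
have -> : 1 - eps - N%:R * hmax = 1 - delta by rewrite opprD addrA.
move=> j jX; rewrite /sigma /sigmat.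
rewrite singular_values_gram_basis (cluster_singular_values_basis N X P).
apply/andP; split; last first.
  apply: (sorted_sqrt_le dX dP') => //; first by rewrite size_image card_ord.
  by rewrite ltW // ltr_pwDl // addr_ge0.
(* The lower bound is the same comparison with the two forms exchanged and constant 1 / (1 - delta),
   which is positive by [dd]. *)
rewrite mulrC -ler_pdivlMr ?sqrtr_gt0 // mulrC -(sqrtrV (ltW dd)).
apply: (sorted_sqrt_le dP' dX) => //; first by rewrite invr_ge0 ltW.
move=> x; rewrite rmorphV ?unitfE ?gt_eqF //= mulrC ler_pdivlMr ?ltcR // mulrC.
exact: lower.
Qed.
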